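(* Fix $L>4\pi$ and let $k_L\in(0,1)$ be the unique number such that $64K^2(k_L)\sqrt{k_L^4-k_L^2+1}=L^2$. For each $k\in(0,k_L)$, the function $$\phi_k(x)=\left[\frac{5}{12}\left(\frac{L^2-64(2k^2-1)K^2(k)}{\tilde m(k)}-1\right)+\frac{80k^2K^2(k)}{\tilde m(k)}\,\mathrm{cn}^2\!\left(\frac{2K(k)}{L}x,k\right)\right]^2,$$ where $\tilde m(k)=L^2-64K^2(k)\sqrt{k^4-k^2+1}$, is a smooth $L$-periodic solution of $$-c\,\phi''+(c-1)\phi-\phi^{3/2}+A=0$$ with $c=c(k)$ and $A=A(k)$ given in the context. In addition, the mapping $$k\in(0,k_L)\mapsto\phi_k\in C^\infty_{per}([0,L])$$ is smooth.
   Context: $K(k)=\int_0^{\pi/2}(1-k^2\sin^2\theta)^{-1/2}d\theta$ is the complete elliptic integral of the first kind and $\mathrm{cn}(\cdot,k)$ is the Jacobi cnoidal elliptic function with modulus $k\in(0,1)$ (parameter $m=k^2$). The function $k\mapsto 64K^2(k)\sqrt{k^4-k^2+1}$ is strictly increasing on $(0,1)$, equals $16\pi^2$ at $k=0$ and tends to $+\infty$ as $k\to1$, so $k_L$ is well defined for $L>4\pi$. $C^\infty_{per}([0,L])$ is the space of smooth $L$-periodic real functions. The parameters are $$c(k)=\frac{L^2}{\tilde m(k)},$$ $$A(k)=\frac{-204800K^6(k)}{27\,\tilde m^3(k)}\left(\sqrt{k^4-k^2+1}-(2k^2-1)\right)^2\left(2\sqrt{k^4-k^2+1}+(2k^2-1)\right).$$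 *)

(* Defs.v *)
(* Classical real numbers of Stdlib, with Coquelicot for analysis. *)
From Stdlib Require Import Reals.
From Coquelicot Require Import Coquelicot.
Open Scope R_scope.

(* Incomplete elliptic integral of the first kind, as a function of the
   amplitude [phi] and the modulus [k] (not the parameter m = k^2). *)
Definition ellF (phi k : R) : R :=
  RInt (fun theta => / sqrt (1 - k ^ 2 * sin theta ^ 2)) 0 phi.

Definition ellK (k : R) : R := ellF (PI / 2) k.

(* Jacobi amplitude: the unique [phi] with [ellF phi k = u].  For 0 < k < 1 the
   map [fun phi => ellF phi k] is an increasing bijection of R, so Coquelicot's
   definite description [iota] picks a genuine inverse. *)
Definition jacobi_am (u k : R) : R := iota (fun phi : R => ellF phi k = u).

Definition jacobi_cn (u k : R) : R := cos (jacobi_am u k).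

Definition m_tilde (L k : R) : R :=
  L ^ 2 - 64 * ellK k ^ 2 * sqrt (k ^ 4 - k ^ 2 + 1).

Definition c_par (L k : R) : R := L ^ 2 / m_tilde L k.

Definition A_par (L k : R) : R :=
  - 204800 * ellK k ^ 6 / (27 * m_tilde L k ^ 3)
  * (sqrt (k ^ 4 - k ^ 2 + 1) - (2 * k ^ 2 - 1)) ^ 2
  * (2 * sqrt (k ^ 4 - k ^ 2 + 1) + (2 * k ^ 2 - 1)).

Definition phi_wave (L k x : R) : R :=
  (5 / 12 * ((L ^ 2 - 64 * (2 * k ^ 2 - 1) * ellK k ^ 2) / m_tilde L k - 1)
   + 80 * k ^ 2 * ellK k ^ 2 / m_tilde L k
     * jacobi_cn (2 * ellK k / L * x) k ^ 2) ^ 2.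

Definition is_kL (L kL : R) : Prop :=
  0 < kL < 1 /\ 64 * ellK kL ^ 2 * sqrt (kL ^ 4 - kL ^ 2 + 1) = L ^ 2.

(* The term f^(3/2) is written [sqrt f ^ 3], which is right for every f >= 0,
   whereas [Rpower 0 (3/2) = 1] in Stdlib. *)
Definition wave_equation (c A : R) (f : R -> R) : Prop :=
  forall x : R,
    - c * Derive_n f 2 x + (c - 1) * f x - sqrt (f x) ^ 3 + A = 0.

Definition Cinf_per (L : R) (f : R -> R) : Prop :=
  (forall (n : nat) (x : R), ex_derive_n f n x) /\
  (forall x : R, f (x + L) = f x).

(* Convergence in the Frechet topology of [Cinf_per L], given by the seminorms
   sup_x |f^(n)(x)|, n = 0, 1, 2, ...; by periodicity the supremum over R is the
   one over [0, L]. *)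
Definition Cinf_cvg {T : Type} (F : (T -> Prop) -> Prop)
    (f : T -> R -> R) (g : R -> R) : Prop :=
  forall (n : nat) (eps : posreal),
    F (fun t => forall x : R, Rabs (Derive_n (f t) n x - Derive_n g n x) < eps).

Definition is_derive_Cinf (gamma : R -> R -> R) (k : R) (d : R -> R) : Prop :=
  Cinf_cvg (locally' 0) (fun h x => (gamma (k + h) x - gamma k x) / h) d.

(* Smoothness of a map from the open interval (a, b) to the Frechet space
   [Cinf_per L]: [G j] is the j-th derivative of [gamma], taken in that space. *)
Definition smooth_curve (L a b : R) (gamma : R -> R -> R) : Prop :=
  exists G : nat -> R -> R -> R,
    G 0%nat = gamma /\
    forall (j : nat) (k : R), a < k < b ->
      Cinf_per L (G j k) /\ is_derive_Cinf (G j) k (G (S j) k).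

(* Main.v *)
Require Import Defs.
From Stdlib Require Import Reals Lra FunctionalExtensionality.
From Coquelicot Require Import Coquelicot.
Open Scope R_scope.

(** Smoothness and the equation both come from placing the wave in an explicit
    ring of functions of [(k, x)] that is closed under partial derivatives.

    Let [theta = am (2 K x / L, k)].  The wave is a polynomial in [k], [K],
    [q = sqrt (k^4 - k^2 + 1)], [1 / m_tilde] and [sin^2 theta].  Differentiating
    brings in only finitely many more functions: [1 / k], [1 / (1 - k^2)], the
    complete integral [E] of the second kind, [1 / q], [sin theta cos theta],
    [dn = sqrt (1 - k^2 sin^2 theta)] and the Jacobi zeta function
    [Z = E (theta, k) - 2 E x / L].  The reasons are the classical formulas for the
    [k]-derivatives of the incomplete elliptic integrals ([is_derive_ellE_modulus],
    [is_derive_ellF_modulus]) and implicit differentiation of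
    [F (theta, k) = 2 K x / L] ([is_derive_implicit_angle]).  The derivative of
    [theta] in [k] a priori contains terms that grow with [x], but they occur only
    in the combination [Z], which is periodic.  So the ring consists of [L]-periodic
    functions, and its elements are represented by syntactic expressions on which
    the two derivations [DX] and [DK] act ([is_derive_eval_x], [is_derive_eval_k]).

    Every element of the ring is bounded uniformly in [x] and locally uniformly in
    [k] ([eval_locally_bounded]).  By the mean value theorem the difference
    quotients in [k] of an element, and of all its [x]-derivatives, then converge
    uniformly in [x]; with [DX] and [DK] commuting ([DX_DK]) this is
    differentiability into the Frechet space ([is_derive_Cinf_eval]), and the
    successive derivatives of the curve are the iterates of [DK].

    Division by [m_tilde] requires [m_tilde > 0] on [(0, kL)] ([m_tilde_pos]), that
    is, strict monotonicity of [K^2 q].  Its derivative is controlled by the bound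
    [E >= sqrt (1 - k^2) K] ([ellE_complete_ge]).

    For the equation, the square root of the wave is a quadratic polynomial
    function of [sn] that is nonnegative because [q >= 2 k^2 - 1].  With the first
    order system for [sn^2], [sn cn] and [dn], everything reduces to a polynomial
    identity modulo [q^2 = k^4 - k^2 + 1] ([wave_equation_phi_wave]). *)

(** * Rules of calculus over the reals *)

(** The derivation rules, with values stated in [R] rather than in a
    normed module, so that [ring] and [field] apply to what they produce. *)
Lemma is_derive_eq (f : R -> R) (x a b : R) :
  is_derive f x a -> a = b -> is_derive f x b.
Proof. now intros H <-. Qed.

Lemma is_derive_fun_eq (f g : R -> R) (x a : R) :
  is_derive f x a -> (forall y, f y = g y) -> is_derive g x a.
Proof. intros H E; exact (is_derive_ext f g x a E H). Qed.

Lemma is_derive_Rplus (f g : R -> R) (x a b : R) :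
  is_derive f x a -> is_derive g x b -> is_derive (fun y => f y + g y) x (a + b).
Proof. intros Hf Hg; exact (is_derive_plus f g x a b Hf Hg). Qed.

Lemma is_derive_Rminus (f g : R -> R) (x a b : R) :
  is_derive f x a -> is_derive g x b -> is_derive (fun y => f y - g y) x (a - b).
Proof. intros Hf Hg; exact (is_derive_minus f g x a b Hf Hg). Qed.

Lemma is_derive_Rmult (f g : R -> R) (x a b : R) :
  is_derive f x a -> is_derive g x b ->
  is_derive (fun y => f y * g y) x (a * g x + f x * b).
Proof. intros Hf Hg; exact (is_derive_mult f g x a b Hf Hg Rmult_comm). Qed.

Lemma is_derive_Rconst (c x : R) : is_derive (fun _ : R => c) x 0.
Proof. exact (is_derive_const c x). Qed.

Lemma is_derive_Rinv (f : R -> R) (x a : R) :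
  is_derive f x a -> f x <> 0 -> is_derive (fun y => / f y) x (- a / f x ^ 2).
Proof. intros Hf H; exact (is_derive_inv f x a Hf H). Qed.

Lemma is_derive_Rcomp (f g : R -> R) (x a b : R) :
  is_derive f (g x) a -> is_derive g x b -> is_derive (fun y => f (g y)) x (b * a).
Proof. intros Hf Hg; exact (is_derive_comp f g x a b Hf Hg). Qed.

(** * Elliptic integrals and their partial derivatives *)

Definition delta (k t : R) : R := sqrt (1 - k ^ 2 * sin t ^ 2).

Definition ellE (phi k : R) : R := RInt (delta k) 0 phi.

Lemma sin2_bounds (t : R) : 0 <= sin t ^ 2 <= 1.
Proof.
generalize (sin2_cos2 t); unfold Rsqr; intros H.
split; nra.
Qed.

Lemma cos_sqr (t : R) : cos t ^ 2 = 1 - sin t ^ 2.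
Proof. generalize (sin2_cos2 t); unfold Rsqr; intros H; lra. Qed.

Lemma delta_radicand_pos (k t : R) : 0 < k < 1 -> 0 < 1 - k ^ 2 * sin t ^ 2.
Proof. intros Hk; pose proof (sin2_bounds t); nra. Qed.

Lemma delta_pos (k t : R) : 0 < k < 1 -> 0 < delta k t.
Proof. intros Hk; apply sqrt_lt_R0, delta_radicand_pos, Hk. Qed.

Lemma delta_sqr (k t : R) : 0 < k < 1 -> delta k t ^ 2 = 1 - k ^ 2 * sin t ^ 2.
Proof.
intros Hk; unfold delta; apply pow2_sqrt.
now apply Rlt_le, delta_radicand_pos.
Qed.

Lemma delta_le_1 (k t : R) : 0 < k < 1 -> delta k t <= 1.
Proof.
intros Hk; pose proof (delta_sqr k t Hk); pose proof (delta_pos k t Hk).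
pose proof (sin2_bounds t); nra.
Qed.

Lemma delta_add_PI (k t : R) : delta k (t + PI) = delta k t.
Proof. unfold delta; rewrite neg_sin; f_equal; ring. Qed.

Lemma delta_PI_sub (k t : R) : delta k (PI - t) = delta k t.
Proof.
unfold delta; replace (PI - t) with (- t + PI) by ring.
rewrite neg_sin, sin_neg; f_equal; ring.
Qed.

Lemma is_derive_delta_angle (k t : R) : 0 < k < 1 ->
  is_derive (delta k) t (- k ^ 2 * sin t * cos t / delta k t).
Proof.
intros Hk; pose proof (delta_radicand_pos k t Hk) as H.
pose proof (delta_pos k t Hk) as Hd.
unfold delta in *; auto_derive.
- exact H.
- field_simplify; [ | lra | ].
  2: { replace (1 + - (k * (k * 1) * (sin t * (sin t * 1))))
        with (1 - k ^ 2 * sin t ^ 2) by ring; lra. }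
  replace (1 + - (k * (k * 1) * (sin t * (sin t * 1))))
        with (1 - k ^ 2 * sin t ^ 2) by ring.
  field; lra.
Qed.

Lemma continuous_delta (k t : R) : 0 < k < 1 -> continuous (delta k) t.
Proof.
intros Hk; apply (ex_derive_continuous (delta k)).
eexists; apply is_derive_delta_angle, Hk.
Qed.

Lemma continuous_inv_delta (k t : R) : 0 < k < 1 ->
  continuous (fun s => / delta k s) t.
Proof.
intros Hk; apply (ex_derive_continuous (fun s => / delta k s)).
eexists; apply is_derive_inv.
- apply is_derive_delta_angle, Hk.
- apply Rgt_not_eq, delta_pos, Hk.
Qed.

Lemma is_derive_RInt_from_0 (f : R -> R) (x : R) :
  (forall t, continuous f t) -> is_derive (fun y => RInt f 0 y) x (f x).
Proof.
intros Hf; apply (is_derive_RInt f (fun y => RInt f 0 y) 0 x); [ | apply Hf].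
apply filter_forall; intros y.
apply (RInt_correct f), (ex_RInt_continuous f); intros; apply Hf.
Qed.

Lemma is_derive_ellF_angle (k phi : R) : 0 < k < 1 ->
  is_derive (fun p => ellF p k) phi (/ delta k phi).
Proof.
intros Hk; apply (is_derive_RInt_from_0 (fun t => / delta k t)); intros t.
now apply continuous_inv_delta.
Qed.

Lemma is_derive_ellE_angle (k phi : R) : 0 < k < 1 ->
  is_derive (fun p => ellE p k) phi (delta k phi).
Proof.
intros Hk; apply (is_derive_RInt_from_0 (delta k)); intros t.
now apply continuous_delta.
Qed.

Lemma RInt_of_primitive (f g : R -> R) (x : R) :
  (forall t, is_derive g t (f t)) -> (forall t, continuous f t) ->
  RInt f 0 x = g x - g 0.
Proof.
intros Hg Hf; apply is_RInt_unique, (is_RInt_derive g f); auto.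
Qed.

Lemma ellF_0 (k : R) : ellF 0 k = 0.
Proof. apply (RInt_point 0 (fun t => / delta k t)). Qed.

Lemma ellE_0 (k : R) : ellE 0 k = 0.
Proof. apply (RInt_point 0 (delta k)). Qed.

Lemma continuity_2d_sin_sqr (u v : R) : continuity_2d_pt (fun _ t => sin t ^ 2) u v.
Proof.
apply (continuity_1d_2d_pt_comp (fun z => sin z ^ 2) (fun _ t => t)).
- apply continuity_pt_filterlim, (ex_derive_continuous (fun z => sin z ^ 2)).
  auto_derive; exact I.
- apply continuity_2d_pt_id2.
Qed.

Lemma continuity_2d_radicand (u v : R) :
  continuity_2d_pt (fun k t => 1 - k ^ 2 * sin t ^ 2) u v.
Proof.
apply continuity_2d_pt_minus; [apply continuity_2d_pt_const | ].
apply continuity_2d_pt_mult; [ | apply continuity_2d_sin_sqr].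
apply (continuity_1d_2d_pt_comp (fun z => z ^ 2) (fun k _ => k)).
- apply continuity_pt_filterlim, (ex_derive_continuous (fun z => z ^ 2)).
  auto_derive; exact I.
- apply continuity_2d_pt_id1.
Qed.

(** Differentiation under the integral sign for integrands that depend on the
    modulus only through [1 - k^2 sin^2 t]; [h := sqrt] and [h := / sqrt] give the
    two elliptic integrals. *)
Lemma is_derive_RInt_modulus (h h' : R -> R) (phi k : R) :
  (forall y, 0 < y -> is_derive h y (h' y)) ->
  (forall y, 0 < y -> continuous h' y) ->
  0 < k < 1 ->
  is_derive (fun k => RInt (fun t => h (1 - k ^ 2 * sin t ^ 2)) 0 phi) k
    (RInt (fun t => - 2 * k * sin t ^ 2 * h' (1 - k ^ 2 * sin t ^ 2)) 0 phi).
Proof.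
intros Hd Hc Hk.
assert (Hnb : locally k (fun y => 0 < y < 1)).
{ apply filter_and; [apply (open_gt 0 k) | apply (open_lt 1 k)]; apply Hk. }
assert (D : forall y t, 0 < y < 1 ->
  is_derive (fun u => h (1 - u ^ 2 * sin t ^ 2)) y
    (- 2 * y * sin t ^ 2 * h' (1 - y ^ 2 * sin t ^ 2))).
{ intros y t Hy.
  apply is_derive_eq with ((- 2 * y * sin t ^ 2) * h' (1 - y ^ 2 * sin t ^ 2)).
  - apply (is_derive_Rcomp h (fun u => 1 - u ^ 2 * sin t ^ 2)).
    + apply Hd, delta_radicand_pos, Hy.
    + auto_derive; [exact I | ring].
  - ring. }
evar_last.
- apply (is_derive_RInt_param (fun k t => h (1 - k ^ 2 * sin t ^ 2))).
  + apply (filter_imp (fun y => 0 < y < 1)); [ | exact Hnb].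
    intros y Hy t _; eexists; apply D, Hy.
  + intros t _.
    apply continuity_2d_pt_ext_loc with
      (fun u v => - 2 * u * sin v ^ 2 * h' (1 - u ^ 2 * sin v ^ 2)).
    { destruct Hnb as [d Hnb]; exists d; intros u v Hu _.
      symmetry; apply is_derive_unique, D, Hnb, Hu. }
    apply continuity_2d_pt_mult.
    * apply continuity_2d_pt_mult; [ | apply continuity_2d_sin_sqr].
      apply continuity_2d_pt_mult;
        [apply continuity_2d_pt_const | apply continuity_2d_pt_id1].
    * apply (continuity_1d_2d_pt_comp h' (fun u v => 1 - u ^ 2 * sin v ^ 2)).
      { apply continuity_pt_filterlim, Hc, delta_radicand_pos, Hk. }
      apply continuity_2d_radicand.
  + apply (filter_imp (fun y => 0 < y < 1)); [ | exact Hnb].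
    intros y Hy; apply (ex_RInt_continuous (fun t => h (1 - y ^ 2 * sin t ^ 2))); intros t _.
    apply (continuous_comp (fun t => 1 - y ^ 2 * sin t ^ 2) h).
    * apply (ex_derive_continuous (fun t => 1 - y ^ 2 * sin t ^ 2)).
      auto_derive; exact I.
    * apply (ex_derive_continuous h).
      eexists; apply Hd, delta_radicand_pos, Hy.
- apply RInt_ext; intros t _; apply is_derive_unique, D, Hk.
Qed.

(** Under the integral sign, [- k sin^2 t / delta = (delta - 1 / delta) / k],
    so the derivative of [ellE] is again a combination of [ellE] and [ellF]. *)
Lemma is_derive_ellE_modulus (k phi : R) : 0 < k < 1 ->
  is_derive (fun k => ellE phi k) k ((ellE phi k - ellF phi k) / k).
Proof.
intros Hk; eapply is_derive_eq.
- apply (is_derive_RInt_modulus sqrt (fun y => / (2 * sqrt y)) phi k); [ | | exact Hk].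
  + intros y Hy; pose proof (sqrt_lt_R0 y Hy); auto_derive; [lra | field; lra].
  + intros y Hy; apply (ex_derive_continuous (fun y => / (2 * sqrt y))).
    pose proof (sqrt_lt_R0 y Hy); auto_derive; repeat split; auto; lra.
- rewrite (RInt_of_primitive _ (fun p => (ellE p k - ellF p k) / k)).
  + rewrite ellE_0, ellF_0; field; lra.
  + intros t; pose proof (delta_pos k t Hk); pose proof (delta_sqr k t Hk) as Hs.
    eapply is_derive_eq.
    * apply (is_derive_Rmult (fun p => ellE p k - ellF p k) (fun _ => / k)).
      -- apply is_derive_Rminus; [apply is_derive_ellE_angle | apply is_derive_ellF_angle];
           exact Hk.
      -- apply is_derive_Rconst.
    * fold (delta k t).
      apply Rmult_eq_reg_r with (k * delta k t); [ | apply Rgt_not_eq, Rmult_lt_0_compat; nra].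
      transitivity (delta k t ^ 2 - 1); [field; lra | ].
      rewrite Hs; field; lra.
  + intros t.
    apply (ex_derive_continuous (fun t => - 2 * k * sin t ^ 2 * / (2 * sqrt (1 - k ^ 2 * sin t ^ 2)))).
    pose proof (delta_radicand_pos k t Hk) as H.
    pose proof (delta_pos k t Hk) as H0; unfold delta in H0.
    auto_derive.
    replace (1 + - (k * (k * 1) * (sin t * (sin t * 1))))
        with (1 - k ^ 2 * sin t ^ 2) by ring; repeat split; lra.
Qed.

(** The closed form of [d ellF / dk], that is, of the integral of
    [k sin^2 t / delta^3] from [0] to [phi]. *)
Definition ellF_dk (phi k : R) : R :=
  (ellE phi k - (1 - k ^ 2) * ellF phi k) / (k * (1 - k ^ 2))
  - k * sin phi * cos phi / ((1 - k ^ 2) * delta k phi).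

(** This is the integration by parts that turns the integral of
    [k sin^2 t / delta^3] into [ellE], [ellF] and a boundary term: the boundary
    term is chosen so that the derivatives agree. *)
Lemma is_derive_ellF_dk_angle (k phi : R) : 0 < k < 1 ->
  is_derive (fun p => ellF_dk p k) phi (k * sin phi ^ 2 / delta k phi ^ 3).
Proof.
intros Hk.
pose proof (delta_pos k phi Hk) as Hd; pose proof (delta_sqr k phi Hk) as Hs.
pose proof (cos_sqr phi) as Hc.
unfold ellF_dk; eapply is_derive_eq.
- apply is_derive_Rminus.
  + apply (is_derive_Rmult _ (fun _ => / (k * (1 - k ^ 2)))).
    * apply is_derive_Rminus; [apply is_derive_ellE_angle, Hk | ].
      apply (is_derive_Rmult (fun _ => 1 - k ^ 2)); [apply is_derive_Rconst | ].
      apply is_derive_ellF_angle, Hk.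
    * apply is_derive_Rconst.
  + apply (is_derive_Rmult (fun p => k * sin p * cos p)).
    * auto_derive; [exact I | reflexivity].
    * apply (is_derive_Rinv (fun p => (1 - k ^ 2) * delta k p));
        [ | apply Rgt_not_eq, Rmult_lt_0_compat; nra].
      apply (is_derive_Rmult (fun _ => 1 - k ^ 2)); [apply is_derive_Rconst | ].
      apply is_derive_delta_angle, Hk.
- cbv beta.
  set (d := delta k phi) in *; set (s := sin phi) in *; set (c := cos phi) in *.
  assert (Hk1 : 1 - k ^ 2 <> 0) by nra.
  apply Rmult_eq_reg_r with (k * (1 - k ^ 2) * d ^ 3);
    [ | repeat apply Rmult_integral_contrapositive_currified; try lra; apply pow_nonzero; lra].
  transitivity (d ^ 4 - (1 - k ^ 2) * d ^ 2
     - k ^ 2 * (c ^ 2 - s ^ 2) * d ^ 2 - k ^ 4 * s ^ 2 * c ^ 2).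
  { field; repeat split; lra. }
  replace (d ^ 4) with ((d ^ 2) ^ 2) by ring.
  rewrite Hs, Hc; field; lra.
Qed.

Lemma is_derive_ellF_modulus (k phi : R) : 0 < k < 1 ->
  is_derive (fun k => ellF phi k) k (ellF_dk phi k).
Proof.
intros Hk.
eapply is_derive_eq.
- apply (is_derive_RInt_modulus (fun y => / sqrt y) (fun y => - / (2 * (sqrt y) ^ 3)) phi k);
    [ | | exact Hk].
  + intros y Hy; pose proof (sqrt_lt_R0 y Hy); auto_derive; [lra | ].
    field; lra.
  + intros y Hy; apply (ex_derive_continuous (fun y => - / (2 * (sqrt y) ^ 3))).
    pose proof (sqrt_lt_R0 y Hy); auto_derive; repeat split; auto.
    apply Rgt_not_eq; repeat apply Rmult_lt_0_compat; lra.
- rewrite (RInt_of_primitive _ (fun p => ellF_dk p k)).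
  + unfold ellF_dk at 2; rewrite ellE_0, ellF_0, sin_0.
    pose proof (delta_pos k 0 Hk); field; repeat split; try lra; nra.
  + intros t; eapply is_derive_eq; [apply is_derive_ellF_dk_angle, Hk | ].
    pose proof (delta_pos k t Hk); fold (delta k t); field; lra.
  + intros t.
    apply (ex_derive_continuous (fun t =>
      - 2 * k * sin t ^ 2 * - / (2 * (sqrt (1 - k ^ 2 * sin t ^ 2)) ^ 3))).
    pose proof (delta_radicand_pos k t Hk) as H.
    pose proof (delta_pos k t Hk) as H0; unfold delta in H0.
    auto_derive.
    replace (1 + - (k * (k * 1) * (sin t * (sin t * 1))))
        with (1 - k ^ 2 * sin t ^ 2) by ring; repeat split; try lra.
    apply Rgt_not_eq; repeat apply Rmult_lt_0_compat; lra.
Qed.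

(** * The amplitude as an implicit function *)

(** The mean value theorem, with the endpoints in either order. *)
Lemma mean_value (f df : R -> R) (a b : R) :
  (forall x, Rmin a b <= x <= Rmax a b -> is_derive f x (df x)) ->
  exists c, Rmin a b <= c <= Rmax a b /\ f b - f a = df c * (b - a).
Proof.
intros H; apply (MVT_gen f a b df).
- intros x Hx; apply H; lra.
- intros x Hx; apply continuity_pt_filterlim, (ex_derive_continuous f).
  eexists; apply H, Hx.
Qed.

Lemma constant_of_derive_0 (f : R -> R) (a b : R) :
  (forall x, is_derive f x 0) -> f a = f b.
Proof.
intros H; destruct (mean_value f (fun _ => 0) a b) as [c [_ E]]; [auto | lra].
Qed.

(** For an integrand with period [PI] that is symmetric about [PI / 2], every
    period contributes the integral over [0, PI], which is twice the integral
    over [0, PI / 2]. *)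
Lemma RInt_periodic_even (f : R -> R) (x : R) :
  (forall t, continuous f t) ->
  (forall t, f (t + PI) = f t) -> (forall t, f (PI - t) = f t) ->
  RInt f 0 (x + PI) = RInt f 0 x + 2 * RInt f 0 (PI / 2).
Proof.
intros Hc Hp He.
pose proof (fun y => is_derive_RInt_from_0 f y Hc) as D.
assert (D1 : forall y, is_derive (fun y => RInt f 0 (y + PI)) y (f y)).
{ intros y; eapply is_derive_eq.
  - apply (is_derive_Rcomp (fun z => RInt f 0 z) (fun z => z + PI)); [apply D | ].
    auto_derive; [exact I | reflexivity].
  - cbv beta; rewrite Hp; ring. }
assert (D2 : forall y, is_derive (fun y => RInt f 0 (PI - y)) y (- f y)).
{ intros y; eapply is_derive_eq.
  - apply (is_derive_Rcomp (fun z => RInt f 0 z) (fun z => PI - z)); [apply D | ].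
    auto_derive; [exact I | reflexivity].
  - cbv beta; rewrite He; ring. }
assert (E1 : RInt f 0 (x + PI) - RInt f 0 x = RInt f 0 (0 + PI) - RInt f 0 0).
{ apply (constant_of_derive_0 (fun y => RInt f 0 (y + PI) - RInt f 0 y)); intros y.
  eapply is_derive_eq; [apply is_derive_Rminus; [apply D1 | apply D] | ring]. }
assert (E2 : RInt f 0 (PI - 0) + RInt f 0 0 = RInt f 0 (PI - PI / 2) + RInt f 0 (PI / 2)).
{ apply (constant_of_derive_0 (fun y => RInt f 0 (PI - y) + RInt f 0 y)); intros y.
  eapply is_derive_eq; [apply is_derive_Rplus; [apply D2 | apply D] | ring]. }
assert (E0 : RInt f 0 0 = 0) by apply (RInt_point 0 f).
replace (PI - PI / 2) with (PI / 2) in E2 by lra.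
rewrite Rplus_0_l in E1; rewrite Rminus_0_r in E2; lra.
Qed.

Lemma ellF_add_PI (phi k : R) : 0 < k < 1 ->
  ellF (phi + PI) k = ellF phi k + 2 * ellK k.
Proof.
intros Hk; apply (RInt_periodic_even (fun t => / delta k t)); intros t.
- now apply continuous_inv_delta.
- now rewrite delta_add_PI.
- now rewrite delta_PI_sub.
Qed.

Lemma ellE_add_PI (phi k : R) : 0 < k < 1 ->
  ellE (phi + PI) k = ellE phi k + 2 * ellE (PI / 2) k.
Proof.
intros Hk; apply (RInt_periodic_even (delta k)); intros t.
- now apply continuous_delta.
- apply delta_add_PI.
- apply delta_PI_sub.
Qed.

(** [delta <= 1] makes the integrand of [ellF] at least [1].  This one inequality
    gives injectivity and surjectivity of [ellF _ k], hence the amplitude. *)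
Lemma ellF_expanding (k a b : R) : 0 < k < 1 -> a <= b ->
  b - a <= ellF b k - ellF a k.
Proof.
intros Hk Hab.
destruct (mean_value (fun p => ellF p k) (fun t => / delta k t) a b) as [c [_ E]].
{ intros x _; now apply is_derive_ellF_angle. }
pose proof (delta_pos k c Hk); pose proof (delta_le_1 k c Hk).
assert (1 <= / delta k c) by (rewrite <- Rinv_1; apply Rinv_le_contravar; lra).
rewrite E; nra.
Qed.

Lemma ellE_increasing (k a b : R) : 0 < k < 1 -> a <= b -> ellE a k <= ellE b k.
Proof.
intros Hk Hab.
destruct (mean_value (fun p => ellE p k) (delta k) a b) as [c [_ E]].
{ intros x _; now apply is_derive_ellE_angle. }
pose proof (delta_pos k c Hk); nra.
Qed.

Lemma ellF_inj (k a b : R) : 0 < k < 1 -> ellF a k = ellF b k -> a = b.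
Proof.
intros Hk E; destruct (Rle_lt_dec a b) as [H | H];
  [pose proof (ellF_expanding k a b Hk H) |
   pose proof (ellF_expanding k b a Hk (Rlt_le _ _ H))]; lra.
Qed.

Lemma ellF_surj (k u : R) : 0 < k < 1 -> exists phi, ellF phi k = u.
Proof.
intros Hk.
assert (Hc : continuity (fun p => ellF p k)).
{ intros p; apply continuity_pt_filterlim, (ex_derive_continuous (fun p => ellF p k)).
  eexists; now apply is_derive_ellF_angle. }
pose proof (Rabs_pos u) as Hu; pose proof (Rle_abs u); pose proof (Rle_abs (- u)) as H1.
rewrite Rabs_Ropp in H1.
pose proof (ellF_expanding k 0 (Rabs u) Hk Hu).
assert (Hu' : - Rabs u <= 0) by lra.
pose proof (ellF_expanding k (- Rabs u) 0 Hk Hu').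
pose proof (ellF_0 k).
destruct (IVT_gen (fun p => ellF p k) (- Rabs u) (Rabs u) u Hc) as [p [_ E]].
- rewrite Rmin_left, Rmax_right by lra; lra.
- now exists p.
Qed.

Lemma ellF_am (u k : R) : 0 < k < 1 -> ellF (jacobi_am u k) k = u.
Proof.
intros Hk; apply (iota_correct (fun phi : R => ellF phi k = u)).
destruct (ellF_surj k u Hk) as [p Hp]; exists p; split; [exact Hp | ].
intros p' Hp'; apply (ellF_inj k _ _ Hk); lra.
Qed.

Lemma am_unique (phi u k : R) : 0 < k < 1 -> ellF phi k = u -> jacobi_am u k = phi.
Proof. intros Hk E; apply (ellF_inj k _ _ Hk); now rewrite ellF_am. Qed.

Lemma ellK_pos (k : R) : 0 < k < 1 -> 0 < ellK k.
Proof.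
intros Hk; pose proof PI_RGT_0.
assert (H0 : 0 <= PI / 2) by lra.
pose proof (ellF_expanding k 0 (PI / 2) Hk H0); rewrite ellF_0 in *.
unfold ellK; lra.
Qed.

Lemma is_derive_ellK (k : R) : 0 < k < 1 ->
  is_derive ellK k ((ellE (PI / 2) k - (1 - k ^ 2) * ellK k) / (k * (1 - k ^ 2))).
Proof.
intros Hk; eapply is_derive_eq; [apply is_derive_ellF_modulus, Hk | ].
unfold ellF_dk, ellK; rewrite cos_PI2; pose proof (delta_pos k (PI / 2) Hk).
field; repeat split; try lra; nra.
Qed.

(** * Positivity of the mass term *)

(** Let [y = sqrt (1 - k^2)].  At [PI / 2] the boundary term of [ellF_dk]
    vanishes, which says that the complete integral [E] also equals [y^2] times
    the integral of [delta^-3].  Averaging the two expressions,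
    [2 (E - y K)] is the integral of
    [delta + y^2 / delta^3 - 2 y / delta = (delta^2 - y)^2 / delta^3 >= 0]. *)
Lemma ellE_complete_ge (k : R) : 0 < k < 1 ->
  sqrt (1 - k ^ 2) * ellK k <= ellE (PI / 2) k.
Proof.
intros Hk.
assert (Hk1 : 0 < 1 - k ^ 2) by nra.
set (y := sqrt (1 - k ^ 2)).
assert (Hy : y ^ 2 = 1 - k ^ 2) by (apply pow2_sqrt; lra).
(* [k * ellF_dk + ellF] is a primitive of [delta^-3]. *)
pose (H := fun p => ellE p k
  + (y ^ 2 * (k * ellF_dk p k) + (y ^ 2 - 2 * y) * ellF p k)).
destruct (mean_value H (fun t => (delta k t ^ 2 - y) ^ 2 / delta k t ^ 3) 0 (PI / 2))
  as [c [_ E]].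
{ intros t _; eapply is_derive_eq.
  - apply is_derive_Rplus; [apply is_derive_ellE_angle, Hk | ].
    apply is_derive_Rplus.
    + apply (is_derive_Rmult (fun _ => y ^ 2)); [apply is_derive_Rconst | ].
      apply (is_derive_Rmult (fun _ => k)); [apply is_derive_Rconst | ].
      apply is_derive_ellF_dk_angle, Hk.
    + apply (is_derive_Rmult (fun _ => y ^ 2 - 2 * y)); [apply is_derive_Rconst | ].
      apply is_derive_ellF_angle, Hk.
  - pose proof (delta_pos k t Hk) as Hd; pose proof (delta_sqr k t Hk) as Hs.
    cbv beta; replace (k * (k * sin t ^ 2 / delta k t ^ 3))
      with ((1 - delta k t ^ 2) / delta k t ^ 3) by (rewrite Hs; field; lra).
    field; lra. }
pose proof (delta_pos k c Hk) as Hd.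
assert (0 <= (delta k c ^ 2 - y) ^ 2 / delta k c ^ 3).
{ apply Rmult_le_pos; [apply pow2_ge_0 | ].
  apply Rlt_le, Rinv_0_lt_compat, pow_lt, Hd. }
assert (HH0 : H 0 = 0).
{ unfold H, ellF_dk; rewrite ellE_0, ellF_0, sin_0.
  pose proof (delta_pos k 0 Hk); field; repeat split; try lra; nra. }
assert (H1 : H (PI / 2) = 2 * (ellE (PI / 2) k - y * ellK k)).
{ unfold H, ellF_dk; rewrite cos_PI2, Hy; fold (ellK k).
  pose proof (delta_pos k (PI / 2) Hk); field; repeat split; try lra; nra. }
pose proof PI_RGT_0; nra.
Qed.

Definition quartic_root (k : R) : R := sqrt (k ^ 4 - k ^ 2 + 1).

Lemma quartic_pos (k : R) : 0 < k ^ 4 - k ^ 2 + 1.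
Proof. replace (k ^ 4) with ((k ^ 2) ^ 2) by ring; nra. Qed.

Lemma quartic_root_pos (k : R) : 0 < quartic_root k.
Proof. apply sqrt_lt_R0, quartic_pos. Qed.

Lemma quartic_root_sqr (k : R) : quartic_root k ^ 2 = k ^ 4 - k ^ 2 + 1.
Proof. apply pow2_sqrt, Rlt_le, quartic_pos. Qed.

Lemma is_derive_quartic_root (k : R) :
  is_derive quartic_root k ((2 * k ^ 3 - k) / quartic_root k).
Proof.
pose proof (quartic_root_pos k) as Hq; pose proof (quartic_pos k) as H.
eapply is_derive_eq.
- apply (is_derive_Rcomp sqrt (fun k => k ^ 4 - k ^ 2 + 1)).
  + apply is_derive_Reals, derivable_pt_lim_sqrt, H.
  + auto_derive; [exact I | reflexivity].
- cbv beta; fold (quartic_root k); simpl; field; lra.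
Qed.

(** The derivative of [k |-> ellK k ^ 2 * quartic_root k]. *)
Definition mass_dk (k : R) : R :=
  2 * ellK k * ((ellE (PI / 2) k - (1 - k ^ 2) * ellK k) / (k * (1 - k ^ 2)))
    * quartic_root k
  + ellK k ^ 2 * ((2 * k ^ 3 - k) / quartic_root k).

Lemma is_derive_m_tilde (L k : R) : 0 < k < 1 ->
  is_derive (m_tilde L) k (- 64 * mass_dk k).
Proof.
intros Hk.
apply (is_derive_fun_eq (fun k => L ^ 2 - 64 * ((ellK k * ellK k) * quartic_root k)));
  [ | intros y; unfold m_tilde, quartic_root; ring].
eapply is_derive_eq.
- apply is_derive_Rminus; [apply is_derive_Rconst | ].
  apply (is_derive_Rmult (fun _ => 64)); [apply is_derive_Rconst | ].
  apply is_derive_Rmult; [ | apply is_derive_quartic_root].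
  apply is_derive_Rmult; apply is_derive_ellK, Hk.
- unfold mass_dk; ring.
Qed.

(** Up to positive factors, with [y = sqrt (1 - k^2)], the claim is
    [2 (1 - y^2 + y^4) E > y^2 (1 + y^2) K].  Since [E >= y K], it is enough that
    [2 (1 - y^2 + y^4) - y (1 + y^2) = (1 - y)^2 (2 + 3 y + 2 y^2)] is positive
    for [y < 1]. *)
Lemma mass_dk_pos (k : R) : 0 < k < 1 -> 0 < mass_dk k.
Proof.
intros Hk; unfold mass_dk.
pose proof (ellK_pos k Hk) as HK; pose proof (ellE_complete_ge k Hk) as HE.
pose proof (quartic_root_pos k) as Hq; pose proof (quartic_root_sqr k) as Hq2.
assert (Hk1 : 0 < 1 - k ^ 2) by nra.
set (y := sqrt (1 - k ^ 2)) in *.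
assert (Hy0 : 0 < y) by (apply sqrt_lt_R0; lra).
assert (Hy : y ^ 2 = 1 - k ^ 2) by (apply pow2_sqrt; lra).
assert (Hy1 : y < 1) by nra.
set (K := ellK k) in *; set (E := ellE (PI / 2) k) in *; set (q := quartic_root k) in *.
replace (2 * K * ((E - (1 - k ^ 2) * K) / (k * (1 - k ^ 2))) * q
  + K ^ 2 * ((2 * k ^ 3 - k) / q))
  with (K * (2 * q ^ 2 * E - K * y ^ 2 * (1 + y ^ 2)) / (k * (1 - k ^ 2) * q)).
- apply Rdiv_lt_0_compat.
  + apply Rmult_lt_0_compat; [exact HK | ].
    assert (Hq3 : q ^ 2 = 1 - y ^ 2 + y ^ 4)
      by (replace (y ^ 4) with ((y ^ 2) ^ 2) by ring; rewrite Hq2, Hy; ring).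
    apply Rlt_le_trans with (2 * q ^ 2 * (y * K) - K * y ^ 2 * (1 + y ^ 2)); [ | nra].
    rewrite Hq3.
    replace (2 * (1 - y ^ 2 + y ^ 4) * (y * K) - K * y ^ 2 * (1 + y ^ 2))
      with (K * y * ((1 - y) ^ 2 * (2 + 3 * y + 2 * y ^ 2))) by ring.
    repeat apply Rmult_lt_0_compat; nra.
  + repeat apply Rmult_lt_0_compat; lra.
- apply Rmult_eq_reg_r with (k * (1 - k ^ 2) * q);
    [ | apply Rgt_not_eq; repeat apply Rmult_lt_0_compat; lra].
  transitivity (K * (2 * q ^ 2 * E - K * y ^ 2 * (1 + y ^ 2))); [field; lra | ].
  transitivity (2 * K * (E - (1 - k ^ 2) * K) * q ^ 2
    + K ^ 2 * (2 * k ^ 3 - k) * k * (1 - k ^ 2)); [ | field; lra].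
  rewrite Hq2, Hy; ring.
Qed.

(** [m_tilde L] vanishes at [kL] and is strictly decreasing before it. *)
Lemma m_tilde_pos (L kL k : R) : is_kL L kL -> 0 < k < kL -> 0 < m_tilde L k.
Proof.
intros [HkL E] Hk.
assert (H0 : m_tilde L kL = 0) by (unfold m_tilde; lra).
destruct (mean_value (m_tilde L) (fun k => - 64 * mass_dk k) k kL) as [c [Hc Em]].
- intros x; rewrite Rmin_left, Rmax_right by lra; intros Hx.
  apply is_derive_m_tilde; lra.
- rewrite Rmin_left, Rmax_right in Hc by lra.
  assert (Hc1 : 0 < c < 1) by lra.
  pose proof (mass_dk_pos c Hc1); nra.
Qed.

(** * Derivatives along curves in the modulus and the angle *)

Lemma continuity_2d_delta (k t : R) : 0 < k < 1 -> continuity_2d_pt delta k t.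
Proof.
intros Hk.
apply (continuity_1d_2d_pt_comp sqrt (fun k t => 1 - k ^ 2 * sin t ^ 2));
  [ | apply continuity_2d_radicand].
apply continuity_pt_sqrt, Rlt_le, delta_radicand_pos, Hk.
Qed.

(** Implicit differentiation of [ellF (theta t) (kap t) = u t].  Let
    [b t := u t - ellF (theta t0) (kap t)].  The mean value theorem in the angle
    gives [theta t - theta t0 = delta (kap t) xi * b t] with [xi] between
    [theta t0] and [theta t].  As [delta <= 1], this forces
    [|xi - theta t0| <= |b t|], which tends to [0]; hence
    [delta (kap t) xi] tends to [delta (kap t0) (theta t0)]. *)
Lemma is_derive_implicit_angle (theta kap u : R -> R) (t0 d : R) :
  0 < kap t0 < 1 -> continuous kap t0 ->
  (forall t, 0 < kap t < 1 -> ellF (theta t) (kap t) = u t) ->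
  is_derive (fun t => u t - ellF (theta t0) (kap t)) t0 d ->
  is_derive theta t0 (delta (kap t0) (theta t0) * d).
Proof.
intros Hk Ck Hth Hd.
set (b := fun t => u t - ellF (theta t0) (kap t)) in Hd.
assert (b0 : b t0 = 0) by (unfold b; rewrite Hth by exact Hk; ring).
assert (Hxi : forall t, 0 < kap t < 1 -> exists xi,
  theta t - theta t0 = delta (kap t) xi * b t /\ Rabs (xi - theta t0) <= Rabs (b t)).
{ intros t Ht.
  destruct (mean_value (fun p => ellF p (kap t)) (fun x => / delta (kap t) x)
    (theta t0) (theta t)) as [xi [Hxi E]].
  { intros x _; now apply is_derive_ellF_angle. }
  pose proof (delta_pos (kap t) xi Ht) as Hp; pose proof (delta_le_1 (kap t) xi Ht).
  assert (E' : theta t - theta t0 = delta (kap t) xi * b t).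
  { unfold b; rewrite <- (Hth t Ht), E; field; lra. }
  exists xi; split; [exact E' | ].
  apply Rle_trans with (Rabs (theta t - theta t0)).
  - destruct (Rle_lt_dec (theta t0) (theta t)).
    + rewrite Rmin_left, Rmax_right in Hxi by lra.
      rewrite !Rabs_pos_eq; lra.
    + rewrite Rmin_right, Rmax_left in Hxi by lra.
      rewrite !Rabs_left1; lra.
  - rewrite E', Rabs_mult, (Rabs_pos_eq (delta _ _)) by lra.
    pose proof (Rabs_pos (b t)); nra. }
apply is_derive_Reals; intros eps Heps.
pose proof (Rabs_pos d) as Hd0.
assert (He1 : 0 < eps / (2 * (Rabs d + 1))) by (apply Rdiv_lt_0_compat; lra).
destruct (continuity_2d_delta (kap t0) (theta t0) Hk (mkposreal _ He1)) as [r Hr].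
simpl in Hr.
assert (He2 : 0 < Rmin 1 (eps / 2)) by (apply Rmin_pos; lra).
pose proof (proj1 (is_derive_Reals b t0 d) Hd _ He2) as [d1 Hd1].
assert (Cb : continuous b t0) by (apply (ex_derive_continuous b); eexists; exact Hd).
destruct (Ck _ (locally_ball (kap t0) r)) as [d2 Hd2].
destruct (Cb _ (locally_ball (b t0) r)) as [d3 Hd3].
destruct (Ck (fun y => 0 < y < 1)) as [d4 Hd4].
{ apply filter_and; [apply (open_gt 0) | apply (open_lt 1)]; apply Hk. }
assert (Hm : 0 < Rmin (Rmin d1 d2) (Rmin d3 d4)).
{ repeat apply Rmin_pos; apply cond_pos. }
exists (mkposreal _ Hm); intros h Hh0 Hh; simpl in Hh.
pose proof (Rmin_l (Rmin d1 d2) (Rmin d3 d4)); pose proof (Rmin_r (Rmin d1 d2) (Rmin d3 d4)).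
pose proof (Rmin_l d1 d2); pose proof (Rmin_r d1 d2).
pose proof (Rmin_l d3 d4); pose proof (Rmin_r d3 d4).
assert (Hball : forall e : posreal, Rabs h < e -> ball t0 e (t0 + h)).
{ intros e He; unfold ball; simpl; unfold AbsRing_ball, abs, minus, plus, opp; simpl.
  now replace (t0 + h + - t0) with h by ring. }
specialize (Hd1 h Hh0 ltac:(lra)).
specialize (Hd2 _ (Hball d2 ltac:(lra))).
specialize (Hd3 _ (Hball d3 ltac:(lra))).
specialize (Hd4 _ (Hball d4 ltac:(lra))).
unfold ball in Hd2, Hd3; simpl in Hd2, Hd3.
unfold AbsRing_ball, abs, minus, plus, opp in Hd2, Hd3; simpl in Hd2, Hd3.
rewrite b0 in Hd1, Hd3; rewrite Ropp_0, Rplus_0_r in Hd3; rewrite Rminus_0_r in Hd1.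
destruct (Hxi (t0 + h) Hd4) as [xi [E Hx]].
rewrite E.
assert (Hdel : Rabs (delta (kap (t0 + h)) xi - delta (kap t0) (theta t0))
  < eps / (2 * (Rabs d + 1))).
{ apply Hr; [exact Hd2 | lra]. }
set (D := delta (kap (t0 + h)) xi) in *; set (D0 := delta (kap t0) (theta t0)) in *.
set (s := b (t0 + h) / h) in *.
replace (D * b (t0 + h) / h - D0 * d) with ((D - D0) * s + D0 * (s - d))
  by (unfold s; field; exact Hh0).
assert (HD0 : 0 < D0 <= 1) by (split; [apply delta_pos | apply delta_le_1]; exact Hk).
assert (Hs : Rabs s < Rabs d + 1).
{ replace s with (d + (s - d)) by ring.
  eapply Rle_lt_trans; [apply Rabs_triang | ].
  pose proof (Rmin_l 1 (eps / 2)); lra. }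
eapply Rle_lt_trans; [apply Rabs_triang | ].
rewrite !Rabs_mult, (Rabs_pos_eq D0) by lra.
pose proof (Rmin_r 1 (eps / 2)); pose proof (Rabs_pos (s - d)).
pose proof (Rabs_pos s); pose proof (Rabs_pos (D - D0)).
assert (Rabs (D - D0) * Rabs s <= eps / 2).
{ replace (eps / 2) with (eps / (2 * (Rabs d + 1)) * (Rabs d + 1)) by (field; lra).
  apply Rmult_le_compat; lra. }
nra.
Qed.

(** * Amplitude and zeta function at the wave variable *)

Definition wave_angle (L k x : R) : R := jacobi_am (2 * ellK k / L * x) k.

(** The Jacobi zeta function at [2 K x / L].  It enters through the derivative of
    the amplitude in [k]: that derivative is the difference of two terms growing
    linearly in [x], and [wave_zeta] is the combination in which the growth
    cancels. *)
Definition wave_zeta (L k x : R) : R :=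
  ellE (wave_angle L k x) k - 2 * ellE (PI / 2) k / L * x.

Lemma ellF_wave_angle (L k x : R) : 0 < k < 1 ->
  ellF (wave_angle L k x) k = 2 * ellK k / L * x.
Proof. intros Hk; apply ellF_am, Hk. Qed.

Lemma wave_angle_period (L k x : R) : 0 < L -> 0 < k < 1 ->
  wave_angle L k (x + L) = wave_angle L k x + PI.
Proof.
intros HL Hk; apply am_unique; [exact Hk | ].
rewrite ellF_add_PI, ellF_wave_angle by exact Hk; field; lra.
Qed.

Lemma is_derive_wave_angle_x (L k x : R) : 0 < L -> 0 < k < 1 ->
  is_derive (wave_angle L k) x (2 * ellK k / L * delta k (wave_angle L k x)).
Proof.
intros HL Hk; eapply is_derive_eq.
- apply (is_derive_implicit_angle (wave_angle L k) (fun _ => k)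
    (fun y => 2 * ellK k / L * y) x (2 * ellK k / L)); [exact Hk | apply continuous_const | | ].
  + intros y _; apply ellF_wave_angle, Hk.
  + auto_derive; [exact I | ring].
- ring.
Qed.

Lemma is_derive_wave_angle_k (L k x : R) : 0 < L -> 0 < k < 1 ->
  is_derive (fun k => wave_angle L k x) k
    (- delta k (wave_angle L k x) * wave_zeta L k x / (k * (1 - k ^ 2))
     + k * (sin (wave_angle L k x) * cos (wave_angle L k x)) / (1 - k ^ 2)).
Proof.
intros HL Hk; eapply is_derive_eq.
- apply (is_derive_implicit_angle (fun k => wave_angle L k x) (fun k => k)
    (fun k => 2 * ellK k / L * x)); [exact Hk | apply continuous_id | | ].
  + intros y Hy; apply ellF_wave_angle, Hy.
  + apply is_derive_Rminus; [ | apply is_derive_ellF_modulus, Hk].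
    apply (is_derive_fun_eq (fun k => ellK k * (2 / L * x)));
      [ | intros y; unfold Rdiv; ring].
    apply is_derive_Rmult; [apply is_derive_ellK, Hk | apply is_derive_Rconst].
- unfold ellF_dk, wave_zeta; rewrite (ellF_wave_angle L k x Hk).
  pose proof (delta_pos k (wave_angle L k x) Hk).
  field; repeat split; try lra; nra.
Qed.

Lemma is_derive_delta_comp (f : R -> R) (k a : R) : 0 < k < 1 ->
  is_derive f k a ->
  is_derive (fun y => delta y (f y)) k
    (- k * sin (f k) ^ 2 / delta k (f k)
     - k ^ 2 * (sin (f k) * cos (f k)) / delta k (f k) * a).
Proof.
intros Hk Hf; pose proof (delta_radicand_pos k (f k) Hk) as H.
pose proof (delta_pos k (f k) Hk) as Hd.
assert (Hs : is_derive (fun y => sin (f y)) k (a * cos (f k))).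
{ apply (is_derive_Rcomp sin f); [ | exact Hf].
  apply is_derive_Reals, derivable_pt_lim_sin. }
eapply is_derive_eq.
- apply (is_derive_Rcomp sqrt (fun y => 1 - y ^ 2 * sin (f y) ^ 2)).
  + apply is_derive_Reals, derivable_pt_lim_sqrt, H.
  + apply (is_derive_fun_eq (fun y => 1 - (y * y) * (sin (f y) * sin (f y))));
      [ | intros y; ring].
    apply is_derive_Rminus; [apply is_derive_Rconst | ].
    apply is_derive_Rmult; apply is_derive_Rmult;
      first [exact Hs | exact (is_derive_id k)].
- cbv beta; fold (delta k (f k)); unfold one; simpl; field; lra.
Qed.

Lemma is_derive_ellE_comp (f : R -> R) (k a : R) : 0 < k < 1 ->
  is_derive f k a ->
  is_derive (fun y => ellE (f y) y) k
    (delta k (f k) * a + (ellE (f k) k - ellF (f k) k) / k).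
Proof.
intros Hk Hf.
assert (Hnb : locally (f k, k) (fun z : R * R => 0 < snd z < 1)).
{ apply (continuous_snd (f k) k (fun y => 0 < y < 1)).
  apply filter_and; [apply (open_gt 0 k) | apply (open_lt 1 k)]; apply Hk. }
eapply is_derive_eq.
- apply is_derive_Reals.
  apply (derivable_pt_lim_comp_2d ellE f (fun y => y) k).
  + apply filterdiff_differentiable_pt_lim.
    apply (is_derive_filterdiff ellE (f k) k (fun p y => delta y p)).
    * apply (filter_imp (fun z : R * R => 0 < snd z < 1)); [ | exact Hnb].
      intros z Hz; apply is_derive_ellE_angle, Hz.
    * apply is_derive_ellE_modulus, Hk.
    * apply (continuity_2d_pt_filterlim (fun p y => delta y p)).
      intros eps; destruct (continuity_2d_delta k (f k) Hk eps) as [r Hr].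
      exists r; intros u v Hu Hv; now apply Hr.
  + apply is_derive_Reals, Hf.
  + apply derivable_pt_lim_id.
- ring.
Qed.

(** * A ring of wave functions closed under both derivations *)

(** Functions of [(k, x)] in whose polynomial ring the wave lies.  The names
    [Sn2], [SnCn], [Dn] and [Zeta] refer to the Jacobi functions [sn^2], [sn cn],
    [dn] and zeta at [2 K x / L].  Taking [sn^2] and [sn cn] rather than [sn] and
    [cn], which change sign over [L], makes every generator [L]-periodic in [x].
    The inverses are generators of their own, so that derivatives stay
    polynomial. *)
Inductive atom : Set :=
  | Modulus | InvModulus | InvComplement | IntK | IntE
  | Quartic | InvQuartic | InvMass
  | Sn2 | SnCn | Dn | Zeta.

Inductive wexpr : Set :=
  | Const (c : R)
  | Atom (a : atom)
  | Add (e f : wexpr)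
  | Mul (e f : wexpr).

Coercion Atom : atom >-> wexpr.
Declare Scope wexpr_scope.
Delimit Scope wexpr_scope with W.
Bind Scope wexpr_scope with wexpr.
Notation "e + f" := (Add e f) : wexpr_scope.
Notation "e * f" := (Mul e f) : wexpr_scope.
Notation "- e" := (Mul (Const (-1)) e) : wexpr_scope.
Notation "e - f" := (Add e (Mul (Const (-1)) f)) : wexpr_scope.

Definition atom_val (L : R) (a : atom) (k x : R) : R :=
  match a with
  | Modulus => k
  | InvModulus => / k
  | InvComplement => / (1 - k ^ 2)
  | IntK => ellK k
  | IntE => ellE (PI / 2) k
  | Quartic => quartic_root k
  | InvQuartic => / quartic_root k
  | InvMass => / m_tilde L k
  | Sn2 => sin (wave_angle L k x) ^ 2
  | SnCn => sin (wave_angle L k x) * cos (wave_angle L k x)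
  | Dn => delta k (wave_angle L k x)
  | Zeta => wave_zeta L k x
  end.

Fixpoint eval (L : R) (e : wexpr) (k x : R) : R :=
  match e with
  | Const c => c
  | Atom a => atom_val L a k x
  | Add e f => eval L e k x + eval L f k x
  | Mul e f => eval L e k x * eval L f k x
  end.

Fixpoint derivation (d : atom -> wexpr) (e : wexpr) : wexpr :=
  match e with
  | Const _ => Const 0
  | Atom a => d a
  | Add e f => derivation d e + derivation d f
  | Mul e f => derivation d e * f + e * derivation d f
  end%W.

(** Partial derivatives of the amplitude at [2 K x / L]. *)
Definition angle_dx (L : R) : wexpr := (Const (2 / L) * IntK * Dn)%W.

Definition angle_dk : wexpr :=
  (Modulus * SnCn * InvComplement - Dn * Zeta * InvModulus * InvComplement)%W.

Definition IntK_dk : wexpr :=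
  (IntE * InvModulus * InvComplement - IntK * InvModulus)%W.

Definition Quartic_dk : wexpr :=
  ((Const 2 * Modulus * Modulus * Modulus - Modulus) * InvQuartic)%W.

(** For [Dn] the chain rule divides by [dn]; [dn^2 = 1 - k^2 sn^2] cancels this
    denominator in both derivatives, which is why no inverse of [Dn] is needed as
    a generator. *)
Definition atom_dx (L : R) (a : atom) : wexpr :=
  match a with
  | Sn2 => Const 2 * SnCn * angle_dx L
  | SnCn => (Const 1 - Const 2 * Sn2) * angle_dx L
  | Dn => - (Const (2 / L) * IntK * Modulus * Modulus * SnCn)
  | Zeta => Const (2 / L) * (IntK * Dn * Dn - IntE)
  | _ => Const 0
  end%W.

Definition atom_dk (a : atom) : wexpr :=
  match a with
  | Modulus => Const 1
  | InvModulus => - (InvModulus * InvModulus)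
  | InvComplement => Const 2 * Modulus * InvComplement * InvComplement
  | IntK => IntK_dk
  | IntE => (IntE - IntK) * InvModulus
  | Quartic => Quartic_dk
  | InvQuartic => - (Quartic_dk * InvQuartic * InvQuartic)
  | InvMass => Const 64 * (Const 2 * IntK * IntK_dk * Quartic + IntK * IntK * Quartic_dk)
                 * InvMass * InvMass
  | Sn2 => Const 2 * SnCn * angle_dk
  | SnCn => (Const 1 - Const 2 * Sn2) * angle_dk
  | Dn => Modulus * InvComplement * (SnCn * Zeta - Sn2 * Dn)
  | Zeta => Dn * angle_dk + Zeta * InvModulus
  end%W.

Definition DX (L : R) : wexpr -> wexpr := derivation (atom_dx L).
Definition DK : wexpr -> wexpr := derivation atom_dk.

Section SmoothFamily.

Variables L kL : R.
Hypothesis L_pos : 0 < L.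
Hypothesis kL_spec : is_kL L kL.

Lemma modulus_range (k : R) : 0 < k < kL -> 0 < k < 1.
Proof. destruct kL_spec as [H _]; lra. Qed.

Lemma is_derive_eval (d : atom -> wexpr) (kap xi : R -> R) (t : R) :
  (forall a, is_derive (fun s => atom_val L a (kap s) (xi s)) t
     (eval L (d a) (kap t) (xi t))) ->
  forall e, is_derive (fun s => eval L e (kap s) (xi s)) t
     (eval L (derivation d e) (kap t) (xi t)).
Proof.
intros Ha; induction e as [c | a | e IHe f IHf | e IHe f IHf].
- exact (is_derive_Rconst c t).
- apply Ha.
- exact (is_derive_Rplus _ _ t _ _ IHe IHf).
- exact (is_derive_Rmult _ _ t _ _ IHe IHf).
Qed.

Lemma is_derive_sin_sqr_comp (f : R -> R) (t a : R) :
  is_derive f t a -> is_derive (fun y => sin (f y) ^ 2) t (2 * (sin (f t) * cos (f t)) * a).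
Proof.
intros Hf; eapply is_derive_eq.
- apply (is_derive_Rcomp (fun z => sin z ^ 2) f); [ | exact Hf].
  auto_derive; [exact I | reflexivity].
- simpl; ring.
Qed.

Lemma is_derive_sin_cos_comp (f : R -> R) (t a : R) :
  is_derive f t a ->
  is_derive (fun y => sin (f y) * cos (f y)) t ((1 - 2 * sin (f t) ^ 2) * a).
Proof.
intros Hf; eapply is_derive_eq.
- apply (is_derive_Rcomp (fun z => sin z * cos z) f); [ | exact Hf].
  auto_derive; [exact I | reflexivity].
- pose proof (cos_sqr (f t)) as Hc.
  replace (1 - 2 * sin (f t) ^ 2) with (cos (f t) ^ 2 - sin (f t) ^ 2) by lra; ring.
Qed.

Lemma is_derive_eval_x (e : wexpr) (k x : R) : 0 < k < 1 ->
  is_derive (eval L e k) x (eval L (DX L e) k x).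
Proof.
intros Hk; apply (is_derive_eval (atom_dx L) (fun _ => k) (fun x => x)).
pose proof (is_derive_wave_angle_x L k x L_pos Hk) as Hth.
pose proof (delta_pos k (wave_angle L k x) Hk) as Hd.
intros []; simpl; try apply is_derive_Rconst.
- eapply is_derive_eq; [apply (is_derive_sin_sqr_comp _ _ _ Hth) | simpl; field; lra].
- eapply is_derive_eq; [apply (is_derive_sin_cos_comp _ _ _ Hth) | simpl; field; lra].
- eapply is_derive_eq.
  + apply (is_derive_Rcomp (delta k) (wave_angle L k)); [ | exact Hth].
    apply is_derive_delta_angle, Hk.
  + simpl; field; lra.
- eapply is_derive_eq.
  + apply is_derive_Rminus.
    * apply (is_derive_Rcomp (fun p => ellE p k) (wave_angle L k)); [ | exact Hth].
      apply is_derive_ellE_angle, Hk.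
    * apply (is_derive_Rmult (fun _ => 2 * ellE (PI / 2) k / L));
        [apply is_derive_Rconst | apply is_derive_Reals, derivable_pt_lim_id].
  + simpl; field; lra.
Qed.

Lemma is_derive_eval_k (e : wexpr) (k x : R) : 0 < k < kL ->
  is_derive (fun k => eval L e k x) k (eval L (DK e) k x).
Proof.
intros HkL; apply (is_derive_eval atom_dk (fun k => k) (fun _ => x)).
pose proof (modulus_range k HkL) as Hk.
pose proof (m_tilde_pos L kL k kL_spec HkL) as Hm.
pose proof (is_derive_wave_angle_k L k x L_pos Hk) as Hth.
pose proof (delta_pos k (wave_angle L k x) Hk) as Hd.
pose proof (delta_sqr k (wave_angle L k x) Hk) as Hs.
pose proof (quartic_root_pos k) as Hq.
assert (Hk1 : 0 < 1 - k ^ 2) by nra.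
assert (Hid : is_derive (fun y : R => y) k 1)
  by (apply is_derive_Reals, derivable_pt_lim_id).
pose proof (is_derive_ellK k Hk) as HK.
intros []; cbn [eval atom_dk atom_val IntK_dk Quartic_dk angle_dk].
- exact Hid.
- eapply is_derive_eq; [apply (is_derive_Rinv (fun y => y)); [exact Hid | lra] | field; lra].
- eapply is_derive_eq; [apply (is_derive_Rinv (fun y => 1 - y ^ 2)); [ | lra] | ].
  + auto_derive; [exact I | reflexivity].
  + field; lra.
- eapply is_derive_eq; [exact HK | field; lra].
- eapply is_derive_eq; [apply is_derive_ellE_modulus, Hk | unfold ellK; field; lra].
- eapply is_derive_eq; [apply is_derive_quartic_root | field; lra].
- eapply is_derive_eq.
  + apply is_derive_Rinv; [apply is_derive_quartic_root | lra].
  + simpl; field; lra.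
- eapply is_derive_eq.
  + apply is_derive_Rinv; [apply is_derive_m_tilde, Hk | lra].
  + unfold mass_dk; simpl; field; repeat split; lra.
- eapply is_derive_eq; [apply (is_derive_sin_sqr_comp _ _ _ Hth) | simpl; field; lra].
- eapply is_derive_eq; [apply (is_derive_sin_cos_comp _ _ _ Hth) | simpl; field; lra].
- eapply is_derive_eq; [apply (is_derive_delta_comp _ _ _ Hk Hth) | ].
  assert (Hp : (sin (wave_angle L k x) * cos (wave_angle L k x)) ^ 2
    = sin (wave_angle L k x) ^ 2 * (1 - sin (wave_angle L k x) ^ 2))
    by (rewrite Rpow_mult_distr, cos_sqr; ring).
  cbv beta.
  set (p := sin (wave_angle L k x) * cos (wave_angle L k x)) in *.
  set (w := sin (wave_angle L k x) ^ 2) in *.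
  set (D := delta k (wave_angle L k x)) in *.
  set (Z := wave_zeta L k x).
  transitivity ((- k * w * (1 - k ^ 2) + k * p * D * Z - k ^ 3 * p ^ 2)
    / (D * (1 - k ^ 2))); [field; repeat split; lra | ].
  transitivity (k * (p * Z * D - w * D ^ 2) / (D * (1 - k ^ 2)));
    [ | field; repeat split; lra].
  f_equal; rewrite Hp, Hs; ring.
- eapply is_derive_eq.
  + apply is_derive_Rminus; [apply (is_derive_ellE_comp _ _ _ Hk Hth) | ].
    apply (is_derive_fun_eq (fun k => ellE (PI / 2) k * (2 / L * x)));
      [ | intros y; unfold Rdiv; ring].
    apply is_derive_Rmult; [apply is_derive_ellE_modulus, Hk | apply is_derive_Rconst].
  + cbv beta; rewrite (ellF_wave_angle L k x Hk); unfold wave_zeta; fold (ellK k).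
    simpl; field; repeat split; lra.
Qed.

Lemma eval_period (e : wexpr) (k x : R) : 0 < k < 1 ->
  eval L e k (x + L) = eval L e k x.
Proof.
intros Hk; induction e as [c | a | e IHe f IHf | e IHe f IHf]; simpl; try congruence.
assert (Hth := wave_angle_period L k x L_pos Hk).
destruct a; simpl; try reflexivity.
- rewrite Hth, neg_sin; ring.
- rewrite Hth, neg_sin, neg_cos; ring.
- rewrite Hth; apply delta_add_PI.
- unfold wave_zeta; rewrite Hth, ellE_add_PI by exact Hk; field; lra.
Qed.

Lemma periodic_on_period (f : R -> R) (x : R) :
  (forall y, f (y + L) = f y) -> exists y, 0 <= y <= L /\ f y = f x.
Proof.
intros Hf.
assert (Hn : forall (n : nat) y, f (y + INR n * L) = f y).
{ induction n as [ | n IH]; intros y.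
  - f_equal; simpl; ring.
  - replace (y + INR (S n) * L) with (y + INR n * L + L) by (rewrite S_INR; ring).
    now rewrite Hf. }
assert (Hpos : forall y, 0 <= y -> exists z, 0 <= z <= L /\ f z = f y).
{ intros y Hy.
  destruct (nfloor_ex (y / L)) as [n [H1 H2]].
  { apply Rmult_le_pos; [exact Hy | apply Rlt_le, Rinv_0_lt_compat, L_pos]. }
  exists (y - INR n * L); split.
  - replace y with (y / L * L) by (field; lra); nra.
  - rewrite <- (Hn n); f_equal; ring. }
destruct (nfloor_ex (Rabs x / L)) as [n [_ H]].
{ apply Rmult_le_pos; [apply Rabs_pos | apply Rlt_le, Rinv_0_lt_compat, L_pos]. }
destruct (Hpos (x + INR (S n) * L)) as [z [Hz E]].
- rewrite S_INR; pose proof (Rle_abs (- x)) as Hx; rewrite Rabs_Ropp in Hx.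
  assert (Rabs x / L * L = Rabs x) by (field; lra); nra.
- exists z; split; [exact Hz | now rewrite E].
Qed.

(** On one period the amplitude runs through [0, PI], so [ellE] of it and the
    linear term both lie between [0] and [2 E]. *)
Lemma wave_zeta_bound (k x : R) : 0 < k < 1 ->
  Rabs (wave_zeta L k x) <= 2 * ellE (PI / 2) k.
Proof.
intros Hk.
destruct (periodic_on_period (wave_zeta L k) x) as [y [Hy <-]].
{ intros z; apply (eval_period Zeta k z Hk). }
pose proof (ellK_pos k Hk) as HK; pose proof PI_RGT_0 as HPI.
pose proof (ellF_wave_angle L k y Hk) as Hth; unfold wave_zeta.
set (th := wave_angle L k y) in *.
assert (E0 := ellF_0 k); assert (E1 := ellF_add_PI 0 k Hk).
assert (E2 := ellE_0 k); assert (E3 := ellE_add_PI 0 k Hk).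
rewrite Rplus_0_l in E1, E3.
assert (Hyl : 0 <= / L * y <= 1).
{ pose proof (Rinv_0_lt_compat L L_pos); assert (/ L * L = 1) by (field; lra); nra. }
assert (Hth1 : ellF th k = 2 * ellK k * (/ L * y)) by (rewrite Hth; field; lra).
assert (H0 : 0 <= th).
{ destruct (Rle_lt_dec 0 th) as [H | H]; [exact H | ].
  pose proof (ellF_expanding k th 0 Hk (Rlt_le _ _ H)); nra. }
assert (H1 : th <= PI).
{ destruct (Rle_lt_dec th PI) as [H | H]; [exact H | ].
  pose proof (ellF_expanding k PI th Hk (Rlt_le _ _ H)); nra. }
pose proof (ellE_increasing k 0 th Hk H0).
pose proof (ellE_increasing k th PI Hk H1).
replace (2 * ellE (PI / 2) k / L * y) with (2 * ellE (PI / 2) k * (/ L * y))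
  by (field; lra).
apply Rabs_le; nra.
Qed.

Lemma locally_bounded_of_derive (f : R -> R) (k a : R) :
  is_derive f k a -> locally k (fun y => Rabs (f y) <= Rabs (f k) + 1).
Proof.
intros Hf.
assert (C : continuous f k) by (apply (ex_derive_continuous f); now exists a).
apply (filter_imp (fun y => ball (f k) (mkposreal 1 Rlt_0_1) (f y)));
  [ | apply C, locally_ball].
intros y Hy; unfold ball in Hy; simpl in Hy.
unfold AbsRing_ball, abs, minus, plus, opp in Hy; simpl in Hy.
replace (f y) with (f k + (f y + - f k)) by ring.
eapply Rle_trans; [apply Rabs_triang | lra].
Qed.

Lemma locally_modulus (k : R) : 0 < k < kL -> locally k (fun y => 0 < y < kL).
Proof.
intros Hk; apply filter_and; [apply (open_gt 0 k) | apply (open_lt kL k)]; apply Hk.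
Qed.

(** The bound is uniform over all [x]: generators that depend on [k] alone are
    continuous, and the others are bounded by constants or by [wave_zeta_bound].
    Applied to second [k]-derivatives, it gives convergence uniform in [x] without
    a compactness argument. *)
Lemma eval_locally_bounded (e : wexpr) (k : R) : 0 < k < kL ->
  exists M, locally k (fun y => forall x, Rabs (eval L e y x) <= M).
Proof.
intros Hk.
induction e as [c | a | e [M HM] f [N HN] | e [M HM] f [N HN]]; simpl.
- exists (Rabs c); apply filter_forall; intros y x; apply Rle_refl.
- assert (Hconst : (forall y x, atom_val L a y x = atom_val L a y 0) ->
    exists M, locally k (fun y => forall x, Rabs (atom_val L a y x) <= M)).
  { intros Hx.
    pose proof (locally_bounded_of_derive _ _ _ (is_derive_eval_k (Atom a) k 0 Hk)) as H.
    eexists; eapply filter_imp; [ | exact H].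
    intros y Hy x; rewrite Hx; exact Hy. }
  destruct a; try (apply Hconst; intros; reflexivity); simpl.
  + exists 1; apply filter_forall; intros y x.
    pose proof (sin2_bounds (wave_angle L y x)); apply Rabs_le; lra.
  + exists 1; apply filter_forall; intros y x.
    pose proof (cos_sqr (wave_angle L y x)); apply Rabs_le; nra.
  + exists 1; apply (filter_imp (fun y => 0 < y < kL)); [ | now apply locally_modulus].
    intros y Hy x; apply modulus_range in Hy.
    pose proof (delta_pos y (wave_angle L y x) Hy).
    pose proof (delta_le_1 y (wave_angle L y x) Hy); apply Rabs_le; lra.
  + pose proof (locally_bounded_of_derive _ _ _
      (is_derive_ellE_modulus k (PI / 2) (modulus_range k Hk))) as H.
    exists (2 * (Rabs (ellE (PI / 2) k) + 1)).
    generalize (filter_and _ _ H (locally_modulus k Hk)); apply filter_imp.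
    intros y [Hb Hy] x; apply modulus_range in Hy.
    pose proof (wave_zeta_bound y x Hy); pose proof (Rle_abs (ellE (PI / 2) y)); lra.
- exists (M + N); generalize (filter_and _ _ HM HN); apply filter_imp.
  intros y [H1 H2] x; eapply Rle_trans; [apply Rabs_triang | ].
  now apply Rplus_le_compat.
- exists (M * N); generalize (filter_and _ _ HM HN); apply filter_imp.
  intros y [H1 H2] x; rewrite Rabs_mult.
  apply Rmult_le_compat; auto; apply Rabs_pos.
Qed.

Definition wequiv (e f : wexpr) : Prop :=
  forall k x, 0 < k < kL -> eval L e k x = eval L f k x.

(** [DX] is syntactic, but on values it is the derivative in [x], hence respects
    equality of values; this lets [DX_DK] be used under further derivations. *)
Lemma DX_wequiv (e f : wexpr) : wequiv e f -> wequiv (DX L e) (DX L f).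
Proof.
intros H k x Hk.
rewrite <- (is_derive_unique _ _ _ (is_derive_eval_x e k x (modulus_range k Hk))).
rewrite <- (is_derive_unique _ _ _ (is_derive_eval_x f k x (modulus_range k Hk))).
apply Derive_ext; intros y; apply H, Hk.
Qed.

Lemma sncn_sqr (t : R) : (sin t * cos t) ^ 2 = sin t ^ 2 * (1 - sin t ^ 2).
Proof. rewrite Rpow_mult_distr, cos_sqr; ring. Qed.

Lemma sn2_of_dn (k t : R) : 0 < k < 1 -> sin t ^ 2 = (1 - delta k t ^ 2) / k ^ 2.
Proof. intros Hk; rewrite delta_sqr by exact Hk; field; lra. Qed.

Lemma angle_dk_dx : wequiv (DX L angle_dk) (DK (angle_dx L)).
Proof.
intros k x Hk; pose proof (modulus_range k Hk) as Hk'.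
assert (Hk1 : 0 < 1 - k ^ 2) by nra.
unfold DX, DK; cbn [derivation eval atom_dx atom_dk atom_val angle_dx angle_dk IntK_dk].
rewrite (sn2_of_dn k (wave_angle L k x) Hk').
field; repeat split; lra.
Qed.

(** Both compositions obey the same Leibniz formula, so their difference is a
    derivation, and commutation has only to be checked on the generators.  On
    these it reduces to [angle_dk_dx], together with [dn^2 = 1 - k^2 sn^2] and
    [sn^2 + cn^2 = 1]. *)
Lemma DX_DK (e : wexpr) : wequiv (DX L (DK e)) (DK (DX L e)).
Proof.
intros k x Hk; pose proof (modulus_range k Hk) as Hk'.
assert (Hk1 : 0 < 1 - k ^ 2) by nra.
pose proof (angle_dk_dx k x Hk) as Hth.
induction e as [c | a | e IHe f IHf | e IHe f IHf].
{ reflexivity. }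
{ unfold DX, DK in *; destruct a;
    cbn [derivation eval atom_dx atom_dk atom_val IntK_dk Quartic_dk]; try ring.
  - rewrite Hth; ring.
  - rewrite Hth; ring.
  - cbn [derivation eval atom_dx atom_dk atom_val angle_dx angle_dk IntK_dk].
    rewrite (sn2_of_dn k (wave_angle L k x) Hk').
    field; repeat split; lra.
  - rewrite Hth.
    cbn [derivation eval atom_dx atom_dk atom_val angle_dx angle_dk IntK_dk].
    pose proof (sncn_sqr (wave_angle L k x)) as Hp.
    rewrite (sn2_of_dn k (wave_angle L k x) Hk') in Hp |- *.
    set (p := sin (wave_angle L k x) * cos (wave_angle L k x)) in *.
    set (D := delta k (wave_angle L k x)) in *.
    (* The two sides differ by a multiple of the relation [Hp]. *)
    match goal with |- ?a = ?b =>
      transitivity (b - 2 / L * ellK k * k ^ 3 / (1 - k ^ 2)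
        * (p ^ 2 - (1 - D ^ 2) / k ^ 2 * (1 - (1 - D ^ 2) / k ^ 2)))
    end; [field; repeat split; lra | rewrite Hp; ring]. }
{ unfold DX, DK in *; simpl; rewrite IHe, IHf; reflexivity. }
{ unfold DX, DK in *; simpl; rewrite IHe, IHf; ring. }
Qed.

Lemma DX_iter_DK (n : nat) (e : wexpr) :
  wequiv (Nat.iter n (DX L) (DK e)) (DK (Nat.iter n (DX L) e)).
Proof.
induction n as [ | n IH]; intros k x Hk; [reflexivity | ]; simpl.
rewrite (DX_wequiv _ _ IH k x Hk); now apply DX_DK.
Qed.

Lemma Derive_n_eval (e : wexpr) (n : nat) (k x : R) : 0 < k < 1 ->
  Derive_n (eval L e k) n x = eval L (Nat.iter n (DX L) e) k x.
Proof.
intros Hk; revert x; induction n as [ | n IH]; intros x; simpl; [reflexivity | ].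
rewrite (Derive_ext _ _ x IH); apply is_derive_unique, is_derive_eval_x, Hk.
Qed.

Lemma ex_derive_n_eval (e : wexpr) (n : nat) (k x : R) : 0 < k < 1 ->
  ex_derive_n (eval L e k) n x.
Proof.
intros Hk; destruct n as [ | n]; simpl; [exact I | ].
apply (ex_derive_ext (eval L (Nat.iter n (DX L) e) k)).
- intros y; now rewrite Derive_n_eval.
- eexists; apply is_derive_eval_x, Hk.
Qed.

Lemma Cinf_per_eval (e : wexpr) (k : R) : 0 < k < 1 -> Cinf_per L (eval L e k).
Proof.
intros Hk; split; intros.
- now apply ex_derive_n_eval.
- now apply eval_period.
Qed.

(** The quotient is [df c] for some [c] between [k] and [k + h], and the mean value
    theorem for [df] bounds [df c - df k]. *)
Lemma second_order_bound (f df ddf : R -> R) (k h M : R) : h <> 0 ->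
  (forall y, Rabs (y - k) <= Rabs h -> is_derive f y (df y)) ->
  (forall y, Rabs (y - k) <= Rabs h -> is_derive df y (ddf y)) ->
  (forall y, Rabs (y - k) <= Rabs h -> Rabs (ddf y) <= M) ->
  Rabs ((f (k + h) - f k) / h - df k) <= M * Rabs h.
Proof.
intros Hh H1 H2 HM.
assert (Hbetween : forall u y, Rabs (u - k) <= Rabs h ->
  Rmin k u <= y <= Rmax k u -> Rabs (y - k) <= Rabs (u - k)).
{ intros u y _ Hy; destruct (Rle_lt_dec k u).
  - rewrite Rmin_left, Rmax_right in Hy by lra; rewrite !Rabs_pos_eq; lra.
  - rewrite Rmin_right, Rmax_left in Hy by lra; rewrite !Rabs_left1; lra. }
assert (Hkh : Rabs (k + h - k) <= Rabs h)
  by (replace (k + h - k) with h by ring; apply Rle_refl).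
destruct (mean_value f df k (k + h)) as [c [Hc E]].
{ intros y Hy; apply H1; eapply Rle_trans; [apply (Hbetween (k + h)) | ]; eauto. }
assert (Hc' : Rabs (c - k) <= Rabs h)
  by (eapply Rle_trans; [apply (Hbetween (k + h)) | ]; eauto).
destruct (mean_value df ddf k c) as [c2 [Hc2 E2]].
{ intros y Hy; apply H2; eapply Rle_trans; [apply (Hbetween c) | ]; eauto. }
assert (Hc2' : Rabs (c2 - k) <= Rabs h)
  by (eapply Rle_trans; [apply (Hbetween c) | ]; eauto).
rewrite E; replace (df c * (k + h - k) / h) with (df c) by (field; exact Hh).
rewrite E2, Rabs_mult.
apply Rmult_le_compat; auto; apply Rabs_pos.
Qed.

(** The [n]-th [x]-derivative of the difference quotient is a difference
    quotient of the element [DX^n e]; its distance to [DK (DX^n e)] is at most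
    [|h|] times a bound of [DK (DK (DX^n e))].  Commutation of the derivations
    identifies [DK (DX^n e)] with the [n]-th [x]-derivative of [DK e]. *)
Lemma is_derive_Cinf_eval (e : wexpr) (k : R) : 0 < k < kL ->
  is_derive_Cinf (eval L e) k (eval L (DK e) k).
Proof.
intros Hk n eps.
set (en := Nat.iter n (DX L) e).
destruct (eval_locally_bounded (DK (DK en)) k Hk) as [M HM].
destruct (filter_and _ _ HM (locally_modulus k Hk)) as [d Hd].
pose proof (Rabs_pos M) as HM0.
assert (Hr : 0 < Rmin d (eps / (Rabs M + 1))).
{ apply Rmin_pos; [apply cond_pos | apply Rdiv_lt_0_compat; [apply cond_pos | lra]]. }
exists (mkposreal _ Hr); intros h Hh Hh0 x.
assert (Hh1 : Rabs h < Rmin d (eps / (Rabs M + 1))).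
{ revert Hh; unfold ball; simpl; unfold AbsRing_ball, abs, minus, plus, opp; simpl.
  now rewrite Ropp_0, Rplus_0_r. }
pose proof (Rmin_l d (eps / (Rabs M + 1))); pose proof (Rmin_r d (eps / (Rabs M + 1))).
assert (Hball : forall y : R, Rabs (y - k) <= Rabs h ->
  (forall x, Rabs (eval L (DK (DK en)) y x) <= M) /\ 0 < y < kL).
{ intros y Hy; apply Hd; unfold ball; simpl; unfold AbsRing_ball, abs, minus, plus, opp; simpl.
  change (y + - k) with (y - k); lra. }
assert (Hkh : 0 < k + h < kL).
{ apply (Hball (k + h)); rewrite Rplus_minus_l; apply Rle_refl. }
assert (Ediff : Derive_n (fun x => (eval L e (k + h) x - eval L e k x) / h) n x
  = (eval L en (k + h) x - eval L en k x) / h).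
{ rewrite (Derive_n_ext _ (fun x => / h * (eval L e (k + h) x - eval L e k x)))
    by (intros t; unfold Rdiv; ring).
  rewrite Derive_n_scal_l, Derive_n_minus.
  - rewrite !Derive_n_eval by (apply modulus_range; assumption).
    fold en; unfold Rdiv; ring.
  - apply filter_forall; intros; apply ex_derive_n_eval, modulus_range, Hkh.
  - apply filter_forall; intros; apply ex_derive_n_eval, modulus_range, Hk. }
rewrite Ediff, Derive_n_eval, DX_iter_DK by (assumption || now apply modulus_range).
fold en.
eapply Rle_lt_trans.
- apply (second_order_bound (fun y => eval L en y x) (fun y => eval L (DK en) y x)
    (fun y => eval L (DK (DK en)) y x) k h M Hh0);
    intros y Hy; destruct (Hball y Hy) as [Hb Hy1].
  + now apply is_derive_eval_k.
  + now apply is_derive_eval_k.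
  + apply Hb.
- apply Rle_lt_trans with ((Rabs M + 1) * Rabs h).
  + apply Rmult_le_compat_r; [apply Rabs_pos | pose proof (Rle_abs M); lra].
  + replace (pos eps) with ((Rabs M + 1) * (eps / (Rabs M + 1))) by (field; lra).
    apply Rmult_lt_compat_l; lra.
Qed.

Lemma smooth_curve_eval (e : wexpr) : smooth_curve L 0 kL (eval L e).
Proof.
exists (fun j => eval L (Nat.iter j DK e)); split; [reflexivity | ].
intros j k Hk; split.
- now apply Cinf_per_eval, modulus_range.
- now apply is_derive_Cinf_eval.
Qed.

End SmoothFamily.

(** * The wave and its equation *)

(** The expression whose square is the wave. *)
Definition root_expr (L : R) : wexpr :=
  (Const (5 / 12) * ((Const (L ^ 2) - Const 64 * (Const 2 * Modulus * Modulus - Const 1)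
                     * IntK * IntK) * InvMass - Const 1)
   + Const 80 * Modulus * Modulus * IntK * IntK * InvMass * (Const 1 - Sn2))%W.

Definition wave_expr (L : R) : wexpr := (root_expr L * root_expr L)%W.

Lemma phi_wave_eval (L : R) : phi_wave L = eval L (wave_expr L).
Proof.
extensionality k; extensionality x.
unfold phi_wave, jacobi_cn; fold (wave_angle L k x); rewrite cos_sqr.
cbn [wave_expr root_expr eval atom_val]; unfold Rdiv; ring.
Qed.

(** The coefficient of [k^2 cn^2] in the square root of the wave.  In terms of it
    all parameters of the equation become polynomial: [c - 1], [A] and
    [c K^2 / L^2]. *)
Definition amplitude (L k : R) : R := 80 * ellK k ^ 2 / m_tilde L k.

Lemma L_sqr_split (L k : R) :
  L ^ 2 = m_tilde L k + 64 * ellK k ^ 2 * quartic_root k.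
Proof. unfold m_tilde, quartic_root; ring. Qed.

(** Substituting [L^2 = m_tilde + 64 K^2 q], where [q] is [quartic_root k],
    removes [L] and leaves [amplitude] times a function of [k] and [sn^2]. *)
Lemma eval_root_expr (L k x : R) : m_tilde L k <> 0 ->
  eval L (root_expr L) k x
  = amplitude L k * ((quartic_root k - (2 * k ^ 2 - 1)) / 3
                     + k ^ 2 * (1 - sin (wave_angle L k x) ^ 2)).
Proof.
intros Hm; cbn [root_expr eval atom_val]; unfold amplitude.
rewrite (L_sqr_split L k); field; exact Hm.
Qed.

(** [q^2 - (2 k^2 - 1)^2 = 3 k^2 (1 - k^2)].  This makes the square root of the
    wave nonnegative, so that [sqrt] recovers it. *)
Lemma quartic_root_ge (k : R) : 0 < k < 1 -> 2 * k ^ 2 - 1 <= quartic_root k.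
Proof.
intros Hk; pose proof (quartic_root_pos k); pose proof (quartic_root_sqr k) as Hq.
assert (0 <= k ^ 2 * (1 - k ^ 2)) by (apply Rmult_le_pos; nra).
assert ((2 * k ^ 2 - 1) ^ 2 <= quartic_root k ^ 2) by (rewrite Hq; nra).
nra.
Qed.

Lemma eval_wave_expr_dxx (L k x : R) : 0 < L -> 0 < k < 1 -> m_tilde L k <> 0 ->
  let w := sin (wave_angle L k x) ^ 2 in
  let y := (quartic_root k - (2 * k ^ 2 - 1)) / 3 + k ^ 2 * (1 - w) in
  eval L (DX L (DX L (wave_expr L))) k x
  = 16 * (ellK k / L) ^ 2 * amplitude L k ^ 2 * k ^ 2
    * (2 * k ^ 2 * w * (1 - w) * (1 - k ^ 2 * w)
       - y * (1 - 2 * w - 2 * k ^ 2 * w + 3 * k ^ 2 * w ^ 2)).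
Proof.
intros HL Hk Hm w y.
pose proof (sncn_sqr (wave_angle L k x)) as Hp.
pose proof (delta_sqr k (wave_angle L k x) Hk) as Hd.
pose proof (eval_root_expr L k x Hm) as Hr.
fold w in Hp, Hd, Hr; fold y in Hr.
set (p := sin (wave_angle L k x) * cos (wave_angle L k x)) in *.
set (D := delta k (wave_angle L k x)) in *.
set (r := root_expr L) in *.
assert (H1 : eval L (DX L r) k x = - 4 * amplitude L k * k ^ 2 * p * (ellK k / L * D)).
{ unfold DX, r; cbn [derivation root_expr eval atom_dx atom_val angle_dx].
  fold p D w; unfold amplitude; field; lra. }
assert (H2 : eval L (DX L (DX L r)) k x = - 8 * amplitude L k * k ^ 2 * (ellK k / L) ^ 2
   * ((1 - 2 * w) * D ^ 2 - k ^ 2 * p ^ 2)).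
{ unfold DX, r; cbn [derivation root_expr eval atom_dx atom_val angle_dx].
  fold p D w; unfold amplitude; field; lra. }
assert (H3 : eval L (DX L (DX L (wave_expr L))) k x
  = 2 * eval L (DX L r) k x ^ 2 + 2 * eval L r k x * eval L (DX L (DX L r)) k x).
{ unfold wave_expr, DX; fold r; cbn [derivation eval]; ring. }
rewrite H3, H2, H1, Hr.
transitivity (16 * (ellK k / L) ^ 2 * amplitude L k ^ 2 * k ^ 2
  * (2 * k ^ 2 * p ^ 2 * D ^ 2 - y * ((1 - 2 * w) * D ^ 2 - k ^ 2 * p ^ 2))); [ring | ].
rewrite Hp, Hd; ring.
Qed.

(** Write [a] for [amplitude], [q] for [quartic_root k] and [y] for the square
    root of the wave divided by [a].  The equation divided by [a^3] is a polynomial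
    identity in [k], [q] and [sn^2], modulo [q^2 = k^4 - k^2 + 1]. *)
Lemma wave_equation_phi_wave (L kL k : R) : 0 < L -> is_kL L kL -> 0 < k < kL ->
  wave_equation (c_par L k) (A_par L k) (phi_wave L k).
Proof.
intros HL HkL Hk x.
assert (Hk1 : 0 < k < 1) by (destruct HkL; lra).
pose proof (m_tilde_pos L kL k HkL Hk) as Hm.
pose proof (ellK_pos k Hk1) as HK.
pose proof (quartic_root_sqr k) as Hq.
assert (Hm0 : m_tilde L k <> 0) by lra.
rewrite phi_wave_eval, Derive_n_eval by assumption.
change (Nat.iter 2 (DX L) (wave_expr L)) with (DX L (DX L (wave_expr L))).
rewrite (eval_wave_expr_dxx L k x HL Hk1 Hm0).
cbn [wave_expr eval]; rewrite (eval_root_expr L k x Hm0).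
set (w := sin (wave_angle L k x) ^ 2).
pose proof (sin2_bounds (wave_angle L k x)) as Hw; fold w in Hw.
assert (Ha : 0 < amplitude L k).
{ unfold amplitude; apply Rdiv_lt_0_compat; [nra | exact Hm]. }
set (y := (quartic_root k - (2 * k ^ 2 - 1)) / 3 + k ^ 2 * (1 - w)).
assert (Hy : 0 <= y).
{ pose proof (quartic_root_ge k Hk1).
  assert (0 <= k ^ 2 * (1 - w)) by (apply Rmult_le_pos; nra).
  unfold y; lra. }
rewrite sqrt_square by (apply Rmult_le_pos; lra).
assert (Hc : c_par L k = 1 + 4 / 5 * amplitude L k * quartic_root k).
{ unfold c_par, amplitude; rewrite (L_sqr_split L k) at 1; field; exact Hm0. }
assert (HcK : c_par L k * (ellK k / L) ^ 2 = amplitude L k / 80).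
{ unfold c_par, amplitude; field; split; lra. }
assert (HA : A_par L k = - 2 / 135 * amplitude L k ^ 3
  * (quartic_root k - (2 * k ^ 2 - 1)) ^ 2 * (2 * quartic_root k + (2 * k ^ 2 - 1))).
{ unfold A_par, amplitude; fold (quartic_root k); field; exact Hm0. }
set (q := quartic_root k) in *; set (a := amplitude L k) in *.
set (G := 2 * k ^ 2 * w * (1 - w) * (1 - k ^ 2 * w)
       - y * (1 - 2 * w - 2 * k ^ 2 * w + 3 * k ^ 2 * w ^ 2)).
transitivity (- 16 * (c_par L k * (ellK k / L) ^ 2) * a ^ 2 * k ^ 2 * G
  + (c_par L k - 1) * (a * y) ^ 2 - (a * y) ^ 3 + A_par L k); [ring | ].
rewrite HcK, Hc, HA.
transitivity (a ^ 3 * (- k ^ 2 / 5 * G + 4 / 5 * q * y ^ 2 - y ^ 3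
  - 2 / 135 * (q - (2 * k ^ 2 - 1)) ^ 2 * (2 * q + (2 * k ^ 2 - 1)))); [field | ].
apply Rmult_eq_0_compat_l; unfold G, y.
(* As a polynomial in [1 - w], the left side has all coefficients divisible by
   [q ^ 2 - (k ^ 4 - k ^ 2 + 1)]; only the two lowest quotients are nonzero. *)
transitivity ((q ^ 2 - (k ^ 4 - k ^ 2 + 1))
  * ((q - (2 * k ^ 2 - 1)) / 45 + k ^ 2 * (1 - w) / 5)); [field | rewrite Hq; ring].
Qed.

Theorem corollary3p7 (L : R) (hL : 4 * PI < L) (kL : R) (hkL : is_kL L kL) :
  (forall k : R, 0 < k < kL ->
     Cinf_per L (phi_wave L k) /\
     wave_equation (c_par L k) (A_par L k) (phi_wave L k)) /\
  smooth_curve L 0 kL (phi_wave L).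
Proof.
assert (HL : 0 < L) by (pose proof PI_RGT_0; lra).
split; [intros k Hk; split | ].
- rewrite phi_wave_eval; apply Cinf_per_eval; [exact HL | destruct hkL; lra].
- now apply (wave_equation_phi_wave L kL).
- rewrite phi_wave_eval; now apply smooth_curve_eval.
Qed.
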